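(* Every finite DS group is solvable.
   Context: For a finite group $G$ and a subset $S\subseteq G\setminus\{1\}$ with $S=S^{-1}$, the Cayley graph $Cay(G,S)$ has vertex set $G$, with $a,b$ adjacent iff $ab^{-1}\in S$. The spectrum of a graph is the multiset of eigenvalues of its adjacency matrix. A finite group $G$ is DS if every Cayley graph $\Gamma$ on $G$ is isomorphic to every (finite simple) graph $\Gamma'$ having the same spectrum as $\Gamma$. *)

(* Defs.v *)
From HB Require Import structures.
From mathcomp Require Import all_boot all_order all_algebra.
From mathcomp Require Import all_fingroup all_solvable all_field.

Set Implicit Arguments.
Unset Strict Implicit.
Unset Printing Implicit Defensive.

Import Order.TTheory GRing.Theory Num.Theory.

Local Open Scope ring_scope.

Definition simple_graph (V : finType) (e : rel V) : Prop :=
  symmetric e /\ irreflexive e.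

Definition adj_mx (V : finType) (e : rel V) : 'M[algC]_#|V| :=
  \matrix_(i < #|V|, j < #|V|) (e (enum_val i) (enum_val j))%:R.

(* The eigenvalues listed with multiplicity; the order of the list is
   unspecified, so spectra are to be compared up to perm_eq. *)
Definition spectrum (V : finType) (e : rel V) : seq algC :=
  sval (closed_field_poly_normal (char_poly (adj_mx e))).

Lemma spectrumE (V : finType) (e : rel V) :
  char_poly (adj_mx e) = \prod_(x <- spectrum e) ('X - x%:P).
Proof.
rewrite /spectrum; case: closed_field_poly_normal => s /= {1}->.
by rewrite (monicP (char_poly_monic _)) scale1r.
Qed.

Lemma mem_spectrum (V : finType) (e : rel V) (x : algC) :
  (x \in spectrum e) = eigenvalue (adj_mx e) x.
Proof. by rewrite eigenvalue_root_char spectrumE root_prod_XsubC. Qed.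

Definition cospectral (V W : finType) (e : rel V) (f : rel W) : Prop :=
  perm_eq (spectrum e) (spectrum f).

Definition isomorphic_graphs (V W : finType) (e : rel V) (f : rel W) : Prop :=
  exists2 h : V -> W, bijective h & forall x y, f (h x) (h y) = e x y.

Definition connection_set (gT : finGroupType) (G : {group gT}) (S : {set gT}) :
  Prop := (S \subset G^#)%g /\ (S^-1)%g = S.

Definition Cay (gT : finGroupType) (G : {group gT}) (S : {set gT}) :
  rel [subg G] := fun a b => (sgval a * (sgval b)^-1 \in S)%g.

Arguments Cay {gT} G S.

Lemma Cay_simple (gT : finGroupType) (G : {group gT}) (S : {set gT}) :
  connection_set G S -> simple_graph (Cay G S).
Proof.
case=> sSG SV; split=> [a b | a]; rewrite /Cay.
  by rewrite -[in LHS]SV mem_invg invMg invgK.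
by rewrite mulgV; apply/negP => /(subsetP sSG); rewrite !inE eqxx.
Qed.

Definition DS (gT : finGroupType) (G : {group gT}) : Prop :=
  forall S : {set gT}, connection_set G S ->
  forall (V : finType) (e : rel V), simple_graph e ->
  cospectral (Cay G S) e -> isomorphic_graphs (Cay G S) e.

(* Main.v *)
Require Import Defs.
From mathcomp Require Import all_boot all_order all_algebra.
From mathcomp Require Import all_fingroup all_solvable all_field.
From mathcomp Require Import integral_char ring.

(* The complete graph K_{d+1} and the strongly regular graphs with spectrum
   {d, 1, -3} lie in a one-parameter family of spectra contained in
   {d, 1, -1, -3}, and so does the complement of k disjoint 4-cycles, which is a
   Cayley graph on every group of order 4k with a subgroup of order 4.  Hence
   5 copies of it (k = 2) are cospectral with 4 K_6 plus the Clebsch graph, and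
   3 copies (k = 3) with 2 K_10 plus the complement of the 4x4 rook's graph, so
   a DS group of large order has no subgroup of order 8, and none of order 12
   containing one of order 4.  For an odd prime p, a noncyclic p-subgroup of
   order at least p^3 is excluded by switching in the rook's graph attached to
   two of its maximal subgroups, blown up by their intersection: the switched
   graph has a vertex without a twin.

   Let H be a minimal nonsolvable subgroup, p the least prime divisor of #|H|
   and P a Sylow p-subgroup.  By the above #|P| <= p^2 or P is cyclic, and then
   'N_H(P) centralises P unless p = 2 and 3 divides #|'N_H(P)|, which yields a
   subgroup of order 12.  Transfer into P contradicts the perfection of H. *)

Set Implicit Arguments.
Unset Strict Implicit.
Unset Printing Implicit Defensive.

Import GRing.Theory Num.Theory FiniteModule.

Local Open Scope ring_scope.

(** * Switching *)

Lemma cospectral_char_poly (V W : finType) (e : rel V) (f : rel W) :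
  char_poly (adj_mx e) = char_poly (adj_mx f) -> cospectral e f.
Proof. by rewrite !spectrumE; apply: prod_XsubC_eq. Qed.

Lemma char_poly_conj (F : fieldType) n (A B U : 'M[F]_n) :
  U \in unitmx -> A *m U = U *m B -> char_poly A = char_poly B.
Proof.
move=> Uu AU; pose Up := map_mx (@polyC F) U.
have detU : \det Up != 0 by rewrite det_map_mx polyC_eq0 -unitfE -unitmxE.
apply: (mulIf detU); rewrite /char_poly [RHS]mulrC -!det_mulmx; congr (\det _).
rewrite /char_poly_mx mulmxBl mulmxBr -!map_mxM AU.
by rewrite mul_scalar_mx mul_mx_scalar.
Qed.

Lemma mulmx_adjE (V : finType) (e : rel V) m (B : 'M[algC]_(#|V|, m)) i j :
  (adj_mx e *m B) i j =
  \sum_(x : V) (e (enum_val i) x)%:R * B (enum_rank x) j.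
Proof.
rewrite mxE (reindex (@enum_rank V)) /=; last by apply: onW_bij;
  apply: enum_rank_bij.
by apply: eq_bigr => x _; rewrite mxE enum_rankK.
Qed.

(* The reflection 1 - w w^T / 2 conjugates the two adjacency matrices. *)
Lemma reflection_cospectral (V : finType) (e e' : rel V) (w t : V -> algC) :
    symmetric e ->
    (forall x, \sum_y (e x y)%:R * w y = - 2 * t x) ->
    \sum_x w x * w x = 4 -> \sum_x t x * w x = 4 ->
    (forall x y, (e' x y)%:R =
       (e x y)%:R + w x * t y + t x * w y - 2 * (w x * w y) :> algC) ->
  cospectral e e'.
Proof.
move=> sym_e Aw ww tw e'E.
pose A := adj_mx e; pose W := \col_i w (enum_val i) : 'cV[algC]_#|V|.
pose T := \col_i t (enum_val i) : 'cV[algC]_#|V|.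
have dotE (f g : V -> algC) :
    (\col_i f (enum_val i) : 'cV[algC]_#|V|)^T *m (\col_i g (enum_val i))
    = (\sum_x f x * g x)%:M.
  apply/matrixP => i j;
    rewrite !ord1 !mxE /= mulr1n [RHS](reindex (@enum_val V V)) /=.
    by apply: eq_bigr => k _; rewrite !mxE.
  exact/onW_bij/enum_val_bij.
have AW : A *m W = - 2 *: T.
  apply/matrixP => i j; rewrite mulmx_adjE !mxE -Aw.
  by apply: eq_bigr => x _; rewrite mxE enum_rankK.
have trA : A^T = A by apply/matrixP => i j; rewrite !mxE sym_e.
have WA : W^T *m A = - 2 *: T^T by rewrite -{1}trA -trmx_mul AW linearZ.
have WW : W^T *m W = 4%:M by rewrite dotE ww.
have TW : T^T *m W = 4%:M by rewrite dotE tw.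
have A'E : adj_mx e' = A + W *m T^T + T *m W^T - 2 *: (W *m W^T).
  by apply/matrixP => i j; rewrite !mxE e'E !big_ord1 !mxE.
(* Since [W^T *m W] is 4, this is the reflection in the hyperplane orthogonal to [W], hence its own
   inverse. *)
pose Q := 1%:M - 2^-1 *: (W *m W^T).
have half2 : (2^-1 * 4 : algC) = 2 by rewrite -[4]/((2 * 2)%:R) natrM mulKf
  ?pnatr_eq0.
have half22 : (2^-1 * 2 : algC) = 1 by rewrite mulVf ?pnatr_eq0.
have QQ : Q *m Q = 1%:M.
  rewrite mulmxBr mulmx1 {2}/Q; apply/eqP; rewrite subr_eq -scalemxAr mulmxA.
  have -> : Q *m W = - W.
    rewrite mulmxBl mul1mx -scalemxAl -mulmxA WW mul_mx_scalar scalerA half2.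
    by rewrite scaler_nat mulr2n opprD addrA subrr add0r.
  by rewrite mulNmx scalerN.
have Qu : Q \in unitmx by case: (mulmx1_unit QQ).
apply: cospectral_char_poly; apply/esym/(char_poly_conj Qu).
have QA : Q *m A = A + W *m T^T.
  rewrite mulmxBl mul1mx -scalemxAl -mulmxA WA -scalemxAr scalerA mulrN half22.
  by rewrite scaleN1r opprK.
rewrite -/A QA mulmxBr mulmx1 -scalemxAr mulmxA.
have -> : adj_mx e' *m W = 2 *: T - 4 *: W.
  rewrite A'E mulmxBl !mulmxDl AW -!mulmxA -scalemxAl -mulmxA WW TW.
  by rewrite !mul_mx_scalar; apply/matrixP => i j; rewrite !mxE; ring.
rewrite mulmxBl -!scalemxAl scalerBr !scalerA half22 half2 scale1r A'E.
by rewrite opprB addrA subrK addrK.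
Qed.

Lemma sum_subg_delta (gT : finGroupType) (G : {group gT}) (f : gT -> algC) c :
  c \in G -> \sum_(z : [subg G]) f (sgval z) * (sgval z == c)%:R = f c.
Proof.
move=> Gc; rewrite (bigD1 (subg G c)) //= subgK // eqxx mulr1 big1 ?addr0 //.
move=> z; apply: contraNeq => nz; rewrite -(inj_eq subg_inj) subgK //.
by apply: contraNT nz => /negPf ->; rewrite mulr0.
Qed.

(** In the Cayley graph of the symmetric difference of [M1] and [M2], left multiplication by [k]
    gives each vertex a twin, that is, another vertex with the same neighbours. A cospectral
    switching leaves the vertex 1 without a twin. The conditions on squares keep [x^-1] and [y^-1]
    out of the switched region, so that they still witness the old adjacencies. *)
Lemma switching_not_DS (gT : finGroupType) (G M1 M2 : {group gT}) (x y k : gT) :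
    M1 \subset G -> M2 \subset G ->
    x \in M1 -> x \notin M2 -> y \in M2 -> y \notin M1 -> x \in 'N(M2)%g ->
    (x * x)%g \notin M2 -> (y * y)%g \notin M1 ->
    k \in M1 -> k \in M2 -> k != 1%g ->
  ~ DS G.
Proof.
move=> sM1 sM2 M1x M2'x M2y M1'y nM2x M2'xx M1'yy M1k M2k nt_k dsG.
pose S := (M1 :\: M2) :|: (M2 :\: M1).
have memS g : (g \in S) = (g \in M1) (+) (g \in M2).
  by rewrite !inE; case: (g \in M1); case: (g \in M2).
have connS : connection_set G S.
  split; last by apply/setP => g; rewrite inE !memS !groupV.
  apply/subsetP => g; rewrite memS !inE => Sg; apply/andP; split.
    by apply: contraTneq Sg => ->; rewrite !group1.
  by case: (boolP (g \in M1)) Sg => [/(subsetP sM1) // | _ /(subsetP sM2)].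
have [sym_e irr_e] := Cay_simple connS.
(* Modulo K = M1 :&: M2 the graph is a rook's graph with rows M1 and columns M2;
   C is a 2x2 subgrid with one vertex in each of its four fibres, F is the union
   of these fibres, and the edges between C and F minus C are flipped. *)
pose C g := [|| g == 1, g == x, g == y | g == x * y]%g.
(* The two rows are [M1], through 1 and [x], and [M1 y], through [y] and [x * y]; the two columns
   are [M2], through 1 and [y], and [M2 x], through [x] and [x * y]. *)
pose m1 g := g \in M1; pose m1' g := (g * y^-1)%g \in M1.
pose m2 g := g \in M2; pose m2' g := (g * x^-1)%g \in M2.
pose F g := (m1 g || m1' g) && (m2 g || m2' g).
have m1xy g : ((g * (x * y)^-1)%g \in M1) = m1' g.
  by rewrite invMg mulgA groupMr ?groupV.
(* The grid closes up because [x] normalises [M2], which puts [x * y] in the coset [M2 x]. *)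
have m2xy g : ((g * (x * y)^-1)%g \in M2) = m2' g.
  have -> : (g * (x * y)^-1 = g * x^-1 * (y ^ x^-1)^-1)%g.
    by rewrite conjgE !invMg !invgK !mulgA mulgKV.
  by rewrite groupMr // groupV memJ_norm ?groupV.
have disj1 g : m1 g -> m1' g = false.
  by move=> m1g; rewrite /m1' groupMl // groupV (negPf M1'y).
have disj2 g : m2 g -> m2' g = false.
  by move=> m2g; rewrite /m2' groupMl // groupV (negPf M2'x).
(* [t] is the checkerboard sign of the four fibres, zero outside [F], and [w] is its restriction to
   [C]. *)
pose w g : algC := (g == 1%g)%:R - (g == x)%:R - (g == y)%:R + (g == (x *
  y)%g)%:R.
pose t g : algC := ((m1 g)%:R - (m1' g)%:R) * ((m2 g)%:R - (m2' g)%:R).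
pose flip g h := [&& C g, F h & ~~ C h].
pose e (a b : [subg G]) := Cay G S a b.
pose e' (a b : [subg G]) := e a b (+) (flip (sgval a) (sgval b) || flip (sgval b)
  (sgval a)).
have Gx : x \in G by apply: subsetP M1x.
have Gy : y \in G by apply: subsetP M2y.
have valm1 : (m1 1%g = true) * (m1 x = true) * (m1 y = false) * (m1 (x * y)%g =
  false).
  by rewrite /m1 group1 M1x (negPf M1'y) groupMl // (negPf M1'y).
have valm1' : (m1' 1%g = false) * (m1' x = false) * (m1' y = true) * (m1' (x *
  y)%g = true).
  by rewrite (disj1 1%g) ?(disj1 x) ?valm1 // /m1' mulgV group1 mulgK M1x.
have valm2 : (m2 1%g = true) * (m2 x = false) * (m2 y = true) * (m2 (x * y)%g =
  false).
  by rewrite /m2 group1 M2y (negPf M2'x) groupMr // (negPf M2'x).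
have valm2' : (m2' 1%g = false) * (m2' x = true) * (m2' y = false) * (m2' (x *
  y)%g = true).
  by rewrite (disj2 1%g) ?(disj2 y) ?valm2 // -(m2xy (x * y)%g) /m2' !mulgV
    !group1.
have nxy (f : gT -> bool) a b : f a != f b -> (a == b) = false.
  by move=> fab; apply: contraNF fab => /eqP ->.
have n_x1 : (x == 1%g) = false by apply: (nxy m2); rewrite !valm2.
have n_y1 : (y == 1%g) = false by apply: (nxy m1); rewrite !valm1.
have n_xy : (x == y) = false by apply: (nxy m1); rewrite !valm1.
have n_xy1 : ((x * y)%g == 1%g) = false by apply: (nxy m1); rewrite !valm1.
have n_xyx : ((x * y)%g == x) = false by apply: (nxy m1); rewrite !valm1.
have n_xyy : ((x * y)%g == y) = false by apply: (nxy m2); rewrite !valm2.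
pose neqE := (n_x1, n_y1, n_xy, n_xy1, n_xyx, n_xyy, eq_sym 1%g x, eq_sym 1%g y,
  eq_sym y x, eq_sym 1%g (x * y)%g, eq_sym x (x * y)%g, eq_sym y (x * y)%g).
pose valmE := (valm1, valm1', valm2, valm2').
have Cw g : C g -> w g = t g.
  by case/or4P => /eqP ->; rewrite /w /t !valmE eqxx !neqE /=; ring.
have nCw g : ~~ C g -> w g = 0.
  by rewrite !negb_or => /and4P[/negPf h1 /negPf h2 /negPf h3 /negPf h4];
    rewrite /w h1 h2 h3 h4 !subr0 addr0.
have CF g : C g -> F g by case/or4P => /eqP ->; rewrite /F !valmE.
have nFt g : ~~ F g -> t g = 0.
  rewrite /F /t; case: (m1 g); case: (m1' g); case: (m2 g);
    case: (m2' g) => //= _;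
  by rewrite ?subrr ?mulr0 ?mul0r.
(* Within the 2x2 grid, two fibres share exactly one of row and column precisely when their signs
   differ. *)
have Ft (a b : [subg G]) : F (sgval a) -> F (sgval b) ->
    t (sgval a) * t (sgval b) = 1 - 2 * (e a b)%:R.
  have half (M : {group gT}) z p q : z \notin M ->
      (p \in M) || ((p * z^-1)%g \in M) -> (q \in M) || ((q * z^-1)%g \in M) ->
    ((p \in M)%:R - ((p * z^-1)%g \in M)%:R) *
    ((q \in M)%:R - ((q * z^-1)%g \in M)%:R)
      = 2 * ((p * q^-1)%g \in M)%:R - 1 :> algC.
    move=> nMz.
    have dis g : g \in M -> ((g * z^-1)%g \in M) = false.
      by move=> Mg; rewrite groupMl // groupV (negPf nMz).
    have zE : ((p * q^-1)%g \in M) = (((p * z^-1) * (q * z^-1)^-1)%g \in M).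
      by rewrite invMg invgK !mulgA mulgKV.
    case: (boolP (p \in M)) => [Mp _ | nMp /= Mpz].
      case: (boolP (q \in M)) => [Mq _ | nMq /= Mqz].
        by rewrite !dis // groupMl // groupV Mq /=; ring.
      by rewrite Mqz dis // groupMl // groupV (negPf nMq) /=; ring.
    case: (boolP (q \in M)) => [Mq _ | nMq /= Mqz].
      by rewrite Mpz dis // groupMr ?groupV // (negPf nMp) /=; ring.
    by rewrite Mpz Mqz zE groupMl // groupV Mqz /=; ring.
  move=> /andP[F1a F2a] /andP[F1b F2b].
  rewrite /t mulrACA (half M1 y) // (half M2 x) // /e /Cay memS.
  by case: (_ \in M1); case: (_ \in M2) => /=; ring.
have sumw (f : gT -> algC) : \sum_(b : [subg G]) f (sgval b) * w (sgval b)
    = f 1%g - f x - f y + f (x * y)%g.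
  under eq_bigr => b _ do rewrite /w mulrDr !mulrBr.
  by rewrite big_split !sumrB /= !sum_subg_delta ?groupM.
have cosp : cospectral (Cay G S) e'.
  apply: (@reflection_cospectral _ _ _ (fun a => w (sgval a)) (fun a => t (sgval
    a))) => //.
  - move=> a.
    rewrite (sumw (fun b => ((sgval a * b^-1)%g \in S)%:R)) !memS invg1 mulg1.
    rewrite m1xy m2xy !(groupMr _ (groupVr M1x)) !(groupMr _ (groupVr M2y)).
    rewrite -/(m1 _) -/(m2 _) -/(m1' _) -/(m2' _) /t.
    case: (boolP (m1 _)) => [/disj1 -> | _];
      case: (boolP (m2 _)) => [/disj2 -> | _] /=.
    + by ring.
    + by case: (m2' _) => /=; ring.
    + by case: (m1' _) => /=; ring.
    + by case: (m1' _); case: (m2' _) => /=; ring.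
  - rewrite sumw /w !eqxx !neqE /=; ring.
  - rewrite sumw /t !valmE /=; ring.
  (* Between [C] and [F] minus [C] only one product of [w] and [t] survives, and it is [1 - 2e],
     which flips the entry; inside [C] the three terms cancel. *)
  - move=> a b; rewrite -/(e a b) /e' /flip.
    case: (boolP (C (sgval a))) => [Ca | nCa];
      case: (boolP (C (sgval b))) => [Cb | nCb].
    + by rewrite /= !andbF addbF !Cw //; ring.
    + rewrite /= andbT orbF (nCw _ nCb) Cw //.
      case: (boolP (F _)) => [Fb | /nFt ->]; last by rewrite addbF; ring.
      by rewrite (Ft a b (CF _ Ca) Fb); case: (e a b) => /=; ring.
    + rewrite /= andbT (nCw _ nCa) [w _]Cw //.
      case: (boolP (F _)) => [Fa | /nFt ->]; last by rewrite addbF; ring.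
      by rewrite (Ft a b Fa (CF _ Cb)); case: (e a b) => /=; ring.
    + by rewrite /= addbF !nCw //; ring.
have sim_e' : simple_graph e'.
  split=> [a b | a]; first by rewrite /e' orbC /e sym_e.
  by rewrite /e' /e irr_e /flip; case: (C _); rewrite ?andbF.
have [h [h' hK h'K] hE] := dsG S connS _ _ sim_e' cosp.
(* Left multiplication by k yields twins in the Cayley graph, and the vertices
   x^-1, y^-1 and k show that 1 has no twin after the switching. *)
pose v := h' (subg G 1%g); pose u := h (subg G (k * sgval v)%g).
have Gk : k \in G by apply: subsetP M1k.
have twin z : e' (subg G 1%g) z = e' u z.
  rewrite -[subg G 1%g]h'K -[z]h'K !hE /Cay -/v subgK ?groupM ?subgP //.
  by rewrite !memS -!mulgA !(groupMl _ M1k) !(groupMl _ M2k).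
have nu1 : u != subg G 1%g.
  rewrite /u -[subg G 1%g]h'K -/v (inj_eq (can_inj hK)) -(inj_eq subg_inj).
  by rewrite subgK ?groupM ?subgP // -{2}[sgval v]mul1g (inj_eq (mulIg _)).
have e1 c : F c = false -> c \in G -> e' (subg G 1%g) (subg G c) = (c \in S).
  by move=> nFc Gc;
    rewrite /e' /e /Cay /flip !subgK ?group1 // nFc (contraFF (@CF c) nFc) andbF
    addbF mul1g !memS !groupV.
have eu c : F c = false -> c \in G -> e' u (subg G c) = ((sgval u * c^-1)%g \in
  S).
  by move=> nFc Gc;
    rewrite /e' /e /Cay /flip !subgK // nFc (contraFF (@CF c) nFc) andbF addbF.
have Fx : F x^-1%g = false.
  rewrite /F /m2 /m2' groupV (negPf M2'x) -invMg groupV (negPf M2'xx).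
  by rewrite andbF.
have Fy : F y^-1%g = false.
  by rewrite /F /m1 /m1' groupV (negPf M1'y) -invMg groupV (negPf M1'yy).
set U := sgval u in eu.
have Ux : (U * x)%g \in S.
  rewrite -[x]invgK -eu ?groupV // -twin e1 ?groupV //.
  by rewrite memS !groupV M1x (negPf M2'x).
have Uy : (U * y)%g \in S.
  rewrite -[y]invgK -eu ?groupV // -twin e1 ?groupV //.
  by rewrite memS !groupV M2y (negPf M1'y).
have nCK g : g \in M1 -> g \in M2 -> C g = (g == 1%g).
  move=> M1g M2g;
    rewrite /C (nxy m2 g x) ?(nxy m1 g y) ?(nxy m1 g (x * y)%g) ?orbF //.
  - by rewrite valm1 /m1 M1g.
  - by rewrite valm1 /m1 M1g.
  - by rewrite valm2 /m2 M2g.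
(* [k] is in the fibre of 1 but not in [C], so the switching makes it a neighbour of 1. *)
have CU : C U (+) ((U * k^-1)%g \in S).
  have := twin (subg G k); rewrite /e' /e /Cay /flip !subgK ?group1 //.
  rewrite mul1g memS !groupV M1k M2k (nCK k) // (negPf nt_k) /= !andbT orbF.
  rewrite /F /m1 /m2 M1k M2k {1}/C eqxx /= andbT orbF => Ck.
  by rewrite addbC -Ck.
move: Ux Uy CU; rewrite !memS (groupMr U M1x) (groupMr U M2y).
rewrite (groupMr U (groupVr M1k)) (groupMr U (groupVr M2k)).
(* If [U] is in [M1], its adjacency to [y^-1] puts it in [M2], and then that to [k] leaves only 1.
   Otherwise its adjacency to [x^-1] excludes [M2] too, so [U] lies in [C] and is [x * y]; then
   [x * y * x] in [M2] forces [x * x] into [M2]. *)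
have [M1U | nM1U] /= := boolP (U \in M1).
  rewrite (groupMl y M1U) (negPf M1'y) /= => _ M2U; rewrite M2U nCK //= addbF.
  by move=> U1; move: nu1; rewrite -(inj_eq subg_inj) subgK ?group1 // -/U U1.
move=> M2Ux _; have [M2U | nM2U] /= := boolP (U \in M2).
  by rewrite (groupMl x M2U) (negPf M2'x) in M2Ux.
rewrite addbF; case/or4P => /eqP defU; move: nM1U nM2U; rewrite defU.
- by rewrite group1.
- by rewrite M1x.
- by rewrite M2y.
move=> _ _; move: M2Ux; rewrite defU.
have -> : (x * y * x = y ^ x^-1 * (x * x))%g.
  by rewrite conjgE invgK !mulgA mulgKV.
by rewrite groupMl ?memJ_norm ?groupV // (negPf M2'xx).
Qed.

(** * Spectra of chains of cosets and of strongly regular graphs *)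

(** Sylvester's determinant identity: one block matrix is factored into block triangular ones in two
    ways. *)
Lemma det_1_mulmxC (R : comNzRingType) m n (B : 'M[R]_(m, n)) (C : 'M[R]_(n, m)) :
  \det (1%:M + B *m C) = \det (1%:M + C *m B).
Proof.
have eqM : block_mx (1%:M + B *m C) (- B) 0 1%:M *m block_mx 1%:M 0 C 1%:M
         = block_mx 1%:M 0 C 1%:M *m block_mx 1%:M (- B) 0 (1%:M + C *m B).
  rewrite !mulmx_block !mulmx1 !mul1mx !mulmx0 !mul0mx !addr0 !add0r.
  by rewrite mulNmx addrK mulmxN addrC addrK.
move/(congr1 determinant): eqM.
by rewrite !det_mulmx !det_ublock !det_lblock !det1 !mul1r !mulr1.
Qed.

Lemma idem_factor (F : fieldType) n (P : 'M[F]_n) : P *m P = P ->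
  exists r (B : 'M[F]_(n, r)) (C : 'M[F]_(r, n)), P = B *m C /\ C *m B = 1%:M.
Proof.
move=> PP; exists (\rank P), (col_base P), (row_base P); split.
  by rewrite mulmx_base.
apply: (row_free_inj (row_base_free P)); apply: (row_full_inj (col_base_full P)).
by rewrite /= mul1mx -(mulmxA (row_base P)) mulmx_base mulmxA mulmx_base.
Qed.

(** Rank factorisation and Sylvester's identity reduce this to a scalar matrix whose size is the
    rank of [P]; in characteristic 0 the trace determines that rank. *)
Lemma det_1_idem (F : numFieldType) n (P : 'M[F]_n) (r : nat) (c : {poly F}) :
    P *m P = P -> \tr P = r%:R ->
  \det (1%:M + c *: map_mx polyC P) = (1 + c) ^+ r.
Proof.
move=> /idem_factor[r' [B [C [-> CB]]]].
rewrite mxtrace_mulC CB mxtrace1 => /eqP; rewrite eqr_nat => /eqP <-.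
rewrite map_mxM scalemxAl det_1_mulmxC -scalemxAr -map_mxM CB map_mx1.
by rewrite scale_scalar_mx mulr1 -raddfD det_scalar.
Qed.

(** Orthogonality turns the matrix into the product of the factors [1 + c i *: P i]. *)
Lemma det_orth_idem (F : numFieldType) n (I : eqType) (s : seq I)
    (P : I -> 'M[F]_n) (mu : I -> nat) (c : I -> {poly F}) :
    uniq s -> (forall i, P i *m P i = P i) ->
    (forall i j, i != j -> P i *m P j = 0) -> (forall i, \tr (P i) = (mu i)%:R) ->
  \det (1%:M + \sum_(i <- s) c i *: map_mx polyC (P i))
    = \prod_(i <- s) (1 + c i) ^+ mu i.
Proof.
move=> Us PP orth trP; elim: s Us => [|i s IHs] /=.
  by rewrite !big_nil addr0 det1.
case/andP=> s'i /IHs IH; rewrite !big_cons -IH -(det_1_idem _ (PP i) (trP i)).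
rewrite -det_mulmx; congr (\det _).
rewrite mulmxDl mul1mx mulmxDr mulmx1 mulmx_sumr [X in _ = _ + (_ + X)]big1_seq
  => [|j /andP[_ sj]].
  by rewrite addr0 addrA addrAC.
rewrite -scalemxAl -scalemxAr -map_mxM orth ?map_mx0 ?scaler0 //.
by apply: contraNneq s'i => ->.
Qed.

Lemma char_poly_orth_idem (F : numFieldType) n (I : finType) (A : 'M[F]_n)
    (P : I -> 'M[F]_n) (l : I -> F) (mu : I -> nat) :
    (forall i, P i *m P i = P i) -> (forall i j, i != j -> P i *m P j = 0) ->
    (forall i, \tr (P i) = (mu i)%:R) ->
    \sum_i P i = 1%:M -> A = \sum_i l i *: P i ->
  char_poly A = \prod_i ('X - (l i)%:P) ^+ mu i.
Proof.
move=> PP orth trP sumP ->.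
(* As the [P i] sum to 1, the matrix ['X - A] is 1 plus the sum of [('X - l i - 1) *: P i]. *)
rewrite (eq_bigr (fun i => (1 + ('X - (l i)%:P - 1)) ^+ mu i)); last first.
  by move=> i _; rewrite addrCA subrr addr0.
rewrite -(det_orth_idem _ (index_enum_uniq I) PP orth trP).
rewrite /char_poly /char_poly_mx; congr (\det _).
have sumPp : 1%:M = \sum_i map_mx polyC (P i) by rewrite -map_mx_sum sumP map_mx1.
rewrite map_mx_sum /= -[X in X%:M]mulr1 -scale_scalar_mx sumPp.
rewrite scaler_sumr -sumrB -big_split /=.
by apply: eq_bigr => i _; rewrite map_mxZ !scalerBl scale1r [RHS]addrC subrK.
Qed.

(** For nested projections the successive differences are orthogonal idempotents with sum 1, of
    ranks [x], [y], [z], [t]. *)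
Lemma char_poly_nested_idem (F : numFieldType) n (X Y Z : 'M[F]_n) (x y z : nat)
    (a b c d : F) :
    X *m X = X -> Y *m Y = Y -> Z *m Z = Z ->
    X *m Y = X -> Y *m X = X -> Y *m Z = Y -> Z *m Y = Y ->
    \tr X = x%:R -> \tr Y = (x + y)%:R -> \tr Z = (x + y + z)%:R ->
    forall t, n = (x + y + z + t)%N ->
  char_poly (a *: X + b *: (Y - X) + c *: (Z - Y) + d *: (1%:M - Z)) =
  ('X - a%:P) ^+ x * ('X - b%:P) ^+ y * ('X - c%:P) ^+ z * ('X - d%:P) ^+ t.
Proof.
move=> XX YY ZZ XY YX YZ ZY trX trY trZ t def_n.
have XZ : X *m Z = X by rewrite -XY -mulmxA YZ.
have ZX : Z *m X = X by rewrite -YX mulmxA ZY.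
pose P (i : 'I_4) := nth X [:: X; Y - X; Z - Y; 1%:M - Z] i.
pose l (i : 'I_4) := nth a [:: a; b; c; d] i.
pose mu (i : 'I_4) := nth x [:: x; y; z; t] i.
rewrite (@char_poly_orth_idem F n 'I_4 _ P l mu).
- by rewrite !big_ord_recl big_ord0 /= mulr1 !mulrA.
- case=> [[|[|[|[|i]]]] //= lt_i4]; rewrite /P /=;
  by rewrite ?mulmxBl ?mulmxBr ?mulmx1 ?mul1mx ?(XX, YY, ZZ, XY, YX, YZ, ZY)
    ?subrr ?subr0.
- case=> [[|[|[|[|i]]]] //= lt_i4] [[|[|[|[|j]]]] //= lt_j4]; rewrite /P //= => _;
  by rewrite ?mulmxBl ?mulmxBr ?mulmx1 ?mul1mx ?(XX, YY, ZZ, XY, YX, YZ, ZY, XZ,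
    ZX) ?subrr.
- case=> [[|[|[|[|i]]]] //= lt_i4];
    rewrite /P /mu //= ?raddfB /= ?trX ?trY ?trZ ?mxtrace1 ?def_n ?natrD; ring.
- rewrite !big_ord_recl big_ord0 /P /= addr0 !addrA.
  by rewrite [X + Y]addrC addrK [Y + Z]addrC addrK [Z + _]addrC addrK.
- by rewrite !big_ord_recl big_ord0 /P /l /= addr0 !addrA.
Qed.

Lemma char_poly_reindex (V : finType) (e : rel V) n (g : 'I_n -> V) :
    bijective g ->
  char_poly (adj_mx e) = char_poly (\matrix_(i < n, j < n) (e (g i) (g j))%:R :
    'M[algC]_n).
Proof.
move=> bij_g; have := bij_eq_card bij_g; rewrite card_ord => def_n; subst n.
pose s := perm (inj_comp enum_rank_inj (bij_inj bij_g)).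
symmetry; apply: (@char_poly_conj _ _ _ _ (perm_mx s)); first exact: unitmx_perm.
rewrite -row_permE -[s in LHS]invgK -col_permE.
have sE i : enum_val (s i) = g i by rewrite permE /= enum_rankK.
by apply/matrixP => i j; rewrite !mxE sE -{2}(permKV s j) sE.
Qed.

(** * Disjoint unions, and graphs built from chains of equivalence relations *)

Definition sum_graph (V W : finType) (e : rel V) (f : rel W) : rel (V + W) :=
  fun a b => match a, b with
             | inl x, inl y => e x y
             | inr x, inr y => f x y
             | _, _ => false
             end.

Lemma sum_graph_simple (V W : finType) (e : rel V) (f : rel W) :
  simple_graph e -> simple_graph f -> simple_graph (sum_graph e f).
Proof.
by move=> [sym_e irr_e] [sym_f irr_f]; split=> [[x|x] [y|y] | [x|x]] /=.
Qed.

Lemma char_poly_sum_graph (V W : finType) (e : rel V) (f : rel W) :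
  char_poly (adj_mx (sum_graph e f)) = char_poly (adj_mx e) * char_poly (adj_mx
    f).
Proof.
(* Listing [V] before [W] makes the adjacency matrix block diagonal. *)
pose g (i : 'I_(#|V| + #|W|)) : V + W :=
  match split i with inl j => inl (enum_val j) | inr j => inr (enum_val j) end.
have bij_g : bijective g.
  exists (fun a => match a with inl x => lshift _ (enum_rank x)
                              | inr x => rshift _ (enum_rank x) end).
    move=> i; rewrite /g -[RHS]splitK; case: (split i) => j /=;
      by rewrite enum_valK.
  by case=> x; rewrite /g ?(unsplitK (inl _)) ?(unsplitK (inr _)) /= ?enum_rankK.
rewrite (char_poly_reindex _ bij_g).
have -> : (\matrix_(i < #|V| + #|W|, j < #|V| + #|W|) (sum_graph e f (g i) (g
  j))%:R : 'M[algC]_(#|V| + #|W|))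
   = block_mx (adj_mx e) 0 0 (adj_mx f).
  apply/matrixP => i j; rewrite -[i]splitK -[j]splitK.
  case: (split i) => i'; case: (split j) => j' /=.
  - by rewrite block_mxEul !mxE /g !(unsplitK (inl _)).
  - by rewrite block_mxEur !mxE /g (unsplitK (inl _)) (unsplitK (inr _)).
  - by rewrite block_mxEdl !mxE /g (unsplitK (inl _)) (unsplitK (inr _)).
  - by rewrite block_mxEdr !mxE /g !(unsplitK (inr _)).
by rewrite /char_poly char_block_diag_mx det_ublock.
Qed.

(** For nested equivalence relations this is the absorption rule of the projections that average
    over classes. *)
Lemma mulmx_adj_class (V : finType) (r s : rel V) (h : nat) :
    (forall x y z, r x z -> s z y = s x y) -> (forall x, #|r x| = h) ->
  adj_mx r *m adj_mx s = h%:R *: adj_mx s.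
Proof.
move=> rs cr; apply/matrixP => i j; rewrite mulmx_adjE !mxE.
rewrite (eq_bigr (fun x => (r (enum_val i) x)%:R * (s (enum_val i) (enum_val
  j))%:R)).
  rewrite -mulr_suml; congr (_ * _);
    rewrite -(cr (enum_val i)) -sum1_card natr_sum.
  by rewrite [RHS]big_mkcond; apply: eq_bigr => x _; rewrite unfold_in;
    case: (r _ _).
move=> x _; rewrite mxE enum_rankK; case: (boolP (r _ x)) => [/rs -> // | _].
by rewrite !mul0r.
Qed.

Lemma tr_adj_mx (V : finType) (r : rel V) : symmetric r -> (adj_mx r)^T = adj_mx
  r.
Proof. by move=> sym_r; apply/matrixP => i j; rewrite !mxE sym_r. Qed.

(** Meant for [rF] inside [rD] inside [rB]. With classes of 2 and 4 elements for [rF] and [rD], each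
    [rB]-class carries the complement of disjoint 4-cycles; with [rD] and [rF] both equality it
    carries a complete graph. *)
Definition chain_rel (V : finType) (rB rD rF : rel V) : rel V :=
  fun x y => rB x y && ~~ rD x y || rF x y && (x != y).

Lemma equivalence_rel_sym (V : finType) (r : rel V) : equivalence_rel r ->
  symmetric r.
Proof. by case/equivalence_relP=> rr lr x y; apply/idP/idP => /lr <-;
  rewrite rr. Qed.

Lemma chain_rel_simple (V : finType) (rB rD rF : rel V) :
    equivalence_rel rB -> equivalence_rel rD -> equivalence_rel rF ->
  simple_graph (chain_rel rB rD rF).
Proof.
move=> eB eD eF; split=> [x y | x]; rewrite /chain_rel.
  by rewrite eq_sym !(equivalence_rel_sym eB x, equivalence_rel_sym eD x,
    equivalence_rel_sym eF x).
by rewrite eqxx (eD x x x) !andbF.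
Qed.

(** With [X], [Y], [Z] the averages over the classes of [rB], [rD], [rF], the adjacency matrix is
    [bX - dY + fZ - 1]. The ranks of [X], [Y], [Z] are the numbers of classes [x], [x + y],
    [x + y + z]. *)
Lemma char_poly_chain_rel (V : finType) (rB rD rF : rel V) (b d f x y z t : nat) :
    equivalence_rel rB -> equivalence_rel rD -> equivalence_rel rF ->
    subrel rF rD -> subrel rD rB ->
    (forall v, #|rB v| = b) -> (forall v, #|rD v| = d) -> (forall v, #|rF v| = f)
      ->
    (0 < b)%N -> (0 < d)%N -> (0 < f)%N ->
    #|V| = (b * x)%N -> #|V| = (d * (x + y))%N -> #|V| = (f * (x + y + z))%N ->
    #|V| = (x + y + z + t)%N ->
  char_poly (adj_mx (chain_rel rB rD rF)) =
    ('X - (b%:R + f%:R - d%:R - 1)%:P) ^+ x * ('X - (f%:R - d%:R - 1)%:P) ^+ y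
    * ('X - (f%:R - 1)%:P) ^+ z * ('X - (-1)%:P) ^+ t.
Proof.
move=> eB eD eF sFD sDB cB cD cF b0 d0 f0 nB nD nF nV.
have nz n : (0 < n)%N -> n%:R != 0 :> algC by rewrite pnatr_eq0 lt0n.
have [[b1 d1] f1] := (nz b b0, nz d d0, nz f f0).
have [[sB sD] sF] := (equivalence_rel_sym eB, equivalence_rel_sym eD,
  equivalence_rel_sym eF).
have sFB : subrel rF rB by move=> u v /sFD/sDB.
pose X := b%:R^-1 *: adj_mx rB; pose Y := d%:R^-1 *: adj_mx rD.
pose Z := f%:R^-1 *: adj_mx rF.
have mulE (r s : rel V) h h' : equivalence_rel s -> subrel r s -> symmetric r ->
    (forall v, #|r v| = h) -> h%:R != 0 :> algC ->
    (h%:R^-1 *: adj_mx r) *m (h'%:R^-1 *: adj_mx s) = h'%:R^-1 *: adj_mx s /\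
    (h'%:R^-1 *: adj_mx s) *m (h%:R^-1 *: adj_mx r) = h'%:R^-1 *: adj_mx s.
  move=> es srs sr cr nzh.
  have E : adj_mx r *m adj_mx s = h%:R *: adj_mx s.
    by apply: mulmx_adj_class => // u v w /srs suw; apply/esym;
      rewrite (es u w v).
  have E' : adj_mx s *m adj_mx r = h%:R *: adj_mx s.
    by apply: trmx_inj; rewrite trmx_mul linearZ /= !tr_adj_mx //;
      apply: equivalence_rel_sym.
  by split; rewrite -scalemxAl -scalemxAr ?E ?E' !scalerA; congr (_ *: _);
    rewrite -mulrA ?mulVf ?mulr1 // mulrCA mulVf ?mulr1.
have trE (r : rel V) h n : equivalence_rel r -> h%:R != 0 :> algC -> #|V| = (h *
  n)%N ->
    \tr (h%:R^-1 *: adj_mx r) = n%:R.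
  move=> er nzh nh; rewrite mxtraceZ /mxtrace.
  rewrite (eq_bigr (fun=> 1)) => [|i _];
    last by rewrite mxE (er (enum_val i) (enum_val i) (enum_val i)).
  by rewrite sumr_const card_ord nh natrM mulKf.
have refl_sub (r : rel V) : subrel r r by [].
have [XX _] := mulE _ _ _ b eB (refl_sub rB) sB cB b1.
have [YY _] := mulE _ _ _ d eD (refl_sub rD) sD cD d1.
have [ZZ _] := mulE _ _ _ f eF (refl_sub rF) sF cF f1.
have [YX XY] := mulE _ _ _ b eB sDB sD cD d1.
have [ZY YZ] := mulE _ _ _ d eD sFD sF cF f1.
rewrite -(char_poly_nested_idem _ _ _ _ XX YY ZZ XY YX YZ ZY
  (trE _ _ _ eB b1 nB) (trE _ _ _ eD d1 nD) (trE _ _ _ eF f1 nF) nV).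
congr char_poly; apply/matrixP => i j; rewrite !mxE /chain_rel.
set u := enum_val i; set v := enum_val j.
rewrite -(inj_eq enum_val_inj) -/u -/v.
have [euv | _] := eqVneq u v.
  by rewrite euv (eB v v v) (eD v v v) (eF v v v) /=; field; rewrite b1 d1 f1.
case Fuv: (rF u v); first by rewrite (sFD _ _ Fuv) (sFB _ _ Fuv) /=; field;
  rewrite b1 d1 f1.
case Duv: (rD u v); first by rewrite (sDB _ _ Duv) /=; field; rewrite b1 d1 f1.
by case: (rB u v) => /=; field; rewrite b1 d1 f1.
Qed.

Definition copies_rel (q : nat) (V : finType) (r : rel V) : rel ('I_q * V) :=
  fun u v => (u.1 == v.1) && r u.2 v.2.

Lemma copies_rel_equiv q (V : finType) (r : rel V) :
  equivalence_rel r -> equivalence_rel (@copies_rel q V r).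
Proof.
move=> er [i x] [j y] [k z]; rewrite /copies_rel /=; split.
  by rewrite eqxx (er z z z).
by case/andP=> /eqP -> rxy; rewrite (er x y z).
Qed.

Lemma card_copies_rel q (V : finType) (r : rel V) h u :
  (forall v, #|r v| = h) -> #|@copies_rel q V r u| = h.
Proof.
move=> cr; rewrite -(cr u.2) -[RHS]mul1n -(card1 u.1) -cardX.
by apply: eq_card => v; rewrite !inE /copies_rel eq_sym.
Qed.

Lemma copies_rel_sub q (V : finType) (r s : rel V) :
  subrel r s -> subrel (@copies_rel q V r) (@copies_rel q V s).
Proof. by move=> rs u v /andP[eq_uv /rs]; rewrite /copies_rel eq_uv. Qed.

Definition coset_rel (gT : finGroupType) (G H : {group gT}) : rel [subg G] :=
  fun a b => (sgval a * (sgval b)^-1)%g \in H.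

Lemma coset_rel_equiv (gT : finGroupType) (G H : {group gT}) :
  equivalence_rel (@coset_rel gT G H).
Proof.
move=> a b c; rewrite /coset_rel mulgV group1; split=> // Hab.
by rewrite -(groupMl (sgval b * _)%g Hab) !mulgA mulgKV.
Qed.

Lemma card_coset_rel (gT : finGroupType) (G H : {group gT}) (a : [subg G]) :
  H \subset G -> #|coset_rel H a| = #|H|.
Proof.
move=> sHG; pose f (b : [subg G]) := (sgval a * (sgval b)^-1)%g.
have inj_f : injective f by move=> b c /mulgI/invg_inj/subg_inj.
rewrite -(card_image inj_f); apply: eq_card => h;
  apply/imageP/idP => [[b Hb ->] // | Hh].
have Gh := subsetP sHG h Hh.
have Gha : (h^-1 * sgval a)%g \in G by rewrite groupM ?groupV ?subgP.
have fh : f (subg G (h^-1 * sgval a)%g) = h by rewrite /f subgK // invMg invgK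
  mulKVg.
by exists (subg G (h^-1 * sgval a)%g); rewrite // unfold_in /coset_rel -/(f _) fh.
Qed.

Lemma coset_rel_sub (gT : finGroupType) (G H K : {group gT}) :
  H \subset K -> subrel (@coset_rel gT G H) (@coset_rel gT G K).
Proof. by move=> /subsetP sHK a b /sHK. Qed.

Lemma Cay_chain_rel (gT : finGroupType) (G B D F : {group gT}) :
  Cay G ((B :\: D) :|: F^#)%g =2 chain_rel (@coset_rel _ G B) (@coset_rel _ G D)
    (@coset_rel _ G F).
Proof.
move=> a b; rewrite /Cay /chain_rel /coset_rel !inE -eq_mulgV1 (inj_eq subg_inj).
by rewrite [X in X || _]andbC [X in _ || X]andbC.
Qed.

Lemma eq_adj_mx (V : finType) (e f : rel V) : e =2 f -> adj_mx e = adj_mx f.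
Proof. by move=> ef; apply/matrixP => i j; rewrite !mxE ef. Qed.

(* The Clebsch graph (folded 5-cube) and the complement of the 4x4 rook's graph.
  *)
Definition clebsch (i j : nat) : bool := Nat.lxor i j \in [:: 1; 2; 4; 8; 15]%N.
Definition corook (i j : nat) : bool := (i %/ 4 != j %/ 4)%N && (i %% 4 != j %%
  4)%N.

(** The equation [A^2 + 2A = 3I + mu J], for a symmetric matrix with zero diagonal, in a form
    decidable by computation. Off the constant vectors it confines eigenvalues to the roots 1 and -3
    of [t^2 + 2t - 3]. *)
Definition srg16 (mu : nat) (e : nat -> nat -> bool) : bool :=
  all (fun i => all (fun j =>
      (count (fun z => e i z && e z j) (iota 0 16) + 2 * e i j == 3 * (i == j) +
        mu)%N
      && (e i j == e j i)) (iota 0 16) && ~~ e i i) (iota 0 16).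

Lemma srg16_clebsch : srg16 2 clebsch. Proof. by vm_compute. Qed.
Lemma srg16_corook : srg16 6 corook. Proof. by vm_compute. Qed.

Definition ord_graph (n : nat) (e : nat -> nat -> bool) : rel 'I_n := fun i j =>
  e i j.

Lemma srg16P (mu : nat) (e : nat -> nat -> bool) : srg16 mu e ->
    simple_graph (@ord_graph 16 e)
    /\ forall i j : 'I_16,
       (\sum_(z < 16) (e i z && e z j) + 2 * e i j = 3 * (i == j) + mu)%N.
Proof.
have mem16 (i : 'I_16) : (i : nat) \in iota 0 16 by rewrite mem_iota ltn_ord.
move=> /allP srg; split=> [|i j].
  split=> [i j | i]; have /andP[/allP sym_e irr_e] := srg _ (mem16 i).
    by have /andP[_ /eqP] := sym_e _ (mem16 j).
  exact: negPf.
have /andP[/allP/(_ _ (mem16 j))/andP[/eqP <- _] _] := srg _ (mem16 i).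
congr (_ + _)%N.
rewrite -sum1_count -(big_mkord xpredT (fun z => (e i z && e z j) : nat)).
by rewrite [RHS]big_mkcond; apply: eq_bigr => z _; case: (_ && _).
Qed.

(** The case [k = 2] has [mu = 2] and degree 5, the case [k = 3] has [mu = 6] and degree 9. The
    vanishing trace of the adjacency matrix fixes the multiplicities of 1 and -3. *)
Lemma char_poly_srg16 (mu k : nat) (e : nat -> nat -> bool) :
    srg16 mu e -> (mu + 6 = 4 * k)%N -> (k == 2) || (k == 3) ->
  char_poly (adj_mx (@ord_graph 16 e)) =
  ('X - (4 * k%:R - 3)%:P) * ('X - 1%:P) ^+ (12 - k) * ('X - (-3)%:P) ^+ (k + 3).
Proof.
move=> /srg16P[[sym_e irr_e] srgE] mu_k k23.
have kk : (k * k + 6 = 5 * k)%N by case/orP: k23 => /eqP ->.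
have bij_id : bijective (@id 'I_16) by exists id.
rewrite (char_poly_reindex _ bij_id).
set A := (X in char_poly X = _).
pose J : 'M[algC]_16 := const_mx 1.
have [X defX] : exists X, X = 16^-1 *: J by exists (16^-1 *: J).
have muE : mu%:R = k%:R * k%:R - k%:R :> algC.
  apply/eqP; rewrite eq_sym subr_eq -natrM -natrD eqr_nat -(eqn_add2r 6) kk.
  by rewrite addnAC mu_k -mulSnr.
have muE' : mu%:R = 4 * k%:R - 6 :> algC.
  by apply/eqP; rewrite eq_sym subr_eq -natrM -natrD eqr_nat mu_k.
have trA : A^T = A by apply/matrixP => i j; rewrite !mxE sym_e.
have AA : A *m A = 3%:M - 2 *: A + mu%:R *: J.
  apply/matrixP => i j; rewrite !mxE /ord_graph.
  have /= := congr1 (fun n => n%:R : algC) (srgE i j); rewrite !natrD natr_sum.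
  rewrite (eq_bigr (fun z => A i z * A z j)) => [|z _];
    last by rewrite !mxE -natrM mulnb.
  by move/(canRL (addrK _)) => ->; rewrite -mulr_natr; ring.
have degA i : \sum_j A i j = 4 * k%:R - 3.
  have /= := congr1 (fun n => n%:R : algC) (srgE i i).
  rewrite eqxx [e i i]irr_e !natrD natr_sum muE'.
  rewrite (eq_bigr (A i)) => [/(canRL (addrK _)) -> | j _];
    first by rewrite !natrM /=; ring.
  by rewrite [e j i]sym_e andbb mxE.
have AJ : A *m J = (4 * k%:R - 3) *: J.
  apply/matrixP => i j; rewrite !mxE -(degA i) mulr1.
  by apply: eq_bigr => z _; rewrite [J _ _]mxE mulr1.
have trJ : J^T = J by apply/matrixP => i j; rewrite !mxE.
have JA : J *m A = (4 * k%:R - 3) *: J.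
  by apply: trmx_inj; rewrite trmx_mul linearZ /= trA trJ.
have JJ : J *m J = 16 *: J.
  apply/matrixP => i j; rewrite !mxE mulr1 (eq_bigr (fun=> 1)) => [|z _].
    by rewrite sumr_const card_ord.
  by rewrite !mxE mulr1.
have n16 : 16 != 0 :> algC by rewrite pnatr_eq0.
have n4 : 4 != 0 :> algC by rewrite pnatr_eq0.
have XX : X *m X = X.
  by rewrite {1 2}defX -scalemxAl -scalemxAr JJ (scalerA _ 16) mulVf // scale1r
    -defX.
have AX : A *m X = (4 * k%:R - 3) *: X by rewrite defX -scalemxAr AJ !scalerA
  mulrC.
have XA : X *m A = (4 * k%:R - 3) *: X by rewrite defX -scalemxAl JA !scalerA
  mulrC.
have JX : J = 16 *: X by rewrite defX scalerA mulfV // scale1r.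
(* [(A + 3) / 4] is 0 and 1 on the eigenspaces of -3 and 1, and [k] on the constants; the correction
   makes it 1 there as well. *)
pose Y := 4^-1 *: (A + 3%:M) - (k%:R - 1) *: X.
have XY : X *m Y = X.
  rewrite mulmxBr -!scalemxAr mulmxDr XA XX mul_mx_scalar.
  by apply/matrixP => i j; rewrite !mxE; field.
have YX : Y *m X = X.
  rewrite mulmxBl -!scalemxAl mulmxDl AX XX mul_scalar_mx.
  by apply/matrixP => i j; rewrite !mxE; field.
have AY : A *m Y = Y + (4 * (k%:R - 1)) *: X.
  rewrite mulmxBr -!scalemxAr mulmxDr AA AX mul_mx_scalar JX muE /Y.
  by apply/matrixP => i j; rewrite !mxE -mulr_natr; field.
have YY : Y *m Y = Y.
  rewrite {1}/Y mulmxBl -!scalemxAl mulmxDl AY XY mul_scalar_mx.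
  by apply/matrixP => i j; rewrite !mxE; field.
have le_k : (k <= 12)%N by case/orP: k23 => /eqP ->.
have trX : \tr X = 1%:R.
  rewrite defX mxtraceZ /mxtrace (eq_bigr (fun=> 1)) => [|i _];
    last by rewrite mxE.
  by rewrite sumr_const card_ord mulVf.
have trY : \tr Y = (1 + (12 - k))%:R.
  rewrite raddfB /= !mxtraceZ trX raddfD /= mxtrace_scalar.
  rewrite [\tr A]big1 => [|i _]; last by rewrite mxE irr_e.
  by rewrite natrD natrB //; field.
(* [Y] occurs twice, so the third eigenvalue has multiplicity 0 and its value 0 is a placeholder. *)
have := @char_poly_nested_idem _ _ X Y Y 1 (12 - k) 0 (4 * k%:R - 3) 1 0 (-3)
  XX YY YY XY YX YY YY trX trY _ (k + 3).
rewrite addn0 => /(_ trY); rewrite expr0 mulr1 expr1 => <-.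
  congr char_poly; apply/matrixP => i j; rewrite !mxE.
  by field.
by case/orP: k23 => /eqP ->.
Qed.

(** * Cospectral mates of the coset graphs *)

Lemma char_poly_coset_chain (V : finType) (rB rD rF : rel V) (k m : nat) :
    equivalence_rel rB -> equivalence_rel rD -> equivalence_rel rF ->
    subrel rF rD -> subrel rD rB ->
    (forall v, #|rB v| = (4 * k.+1)%N) -> (forall v, #|rD v| = 4) ->
    (forall v, #|rF v| = 2) -> #|V| = (4 * k.+1 * m)%N ->
  char_poly (adj_mx (chain_rel rB rD rF)) =
    (('X - (4 * k.+1%:R - 3)%:P) * ('X - (-3)%:P) ^+ k
     * ('X - 1%:P) ^+ k.+1 * ('X - (-1)%:P) ^+ (2 * k.+1)) ^+ m.
Proof.
move=> eB eD eF sFD sDB cB cD cF oV.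
rewrite (@char_poly_chain_rel _ _ _ _ _ _ _ m (k * m) (k.+1 * m) (2 * k.+1 * m)
  eB eD eF sFD sDB cB cD cF) //.
- rewrite !exprMn -!exprM natrM;
    congr (('X - _%:P) ^+ _ * ('X - _%:P) ^+ _ * ('X - _%:P) ^+ _ * _).
  + by ring.
  + by ring.
  + by ring.
- by rewrite oV; ring.
- by rewrite oV; ring.
- by rewrite oV; ring.
Qed.

Definition full_rel (V : finType) : rel V := fun _ _ => true.

(** A complete graph is the chain graph with class sizes [n.+1], 1, 1; two of the four eigenvalues
    then have multiplicity 0. *)
Lemma char_poly_copies_complete (j n : nat) :
  char_poly (adj_mx (chain_rel (@copies_rel j _ (@full_rel 'I_n.+1))
     (@copies_rel j _ eq_op) (@copies_rel j _ eq_op))) =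
  (('X - (n%:R)%:P) * ('X - (-1)%:P) ^+ n) ^+ j.
Proof.
have eT : equivalence_rel (@full_rel 'I_n.+1) by [].
have eE : equivalence_rel (@eq_op 'I_n.+1).
  by move=> x y z; split=> // /eqP ->.
rewrite (@char_poly_chain_rel _ _ _ _ n.+1 1 1 j (n * j) 0 0) //.
- rewrite !expr0 !mulr1 exprMn -exprM.
  congr (('X - _%:P) ^+ _ * ('X - _%:P) ^+ _); last by ring.
  by rewrite -natr1; ring.
- exact: copies_rel_equiv.
- exact: copies_rel_equiv.
- exact: copies_rel_equiv.
- exact: copies_rel_sub.
- by move=> v; apply: card_copies_rel => u; rewrite -[RHS]card_ord;
    apply: eq_card.
- by move=> v; apply: card_copies_rel => u; rewrite -(card1 u);
    apply: eq_card => w; rewrite !inE eq_sym.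
- by move=> v; apply: card_copies_rel => u; rewrite -(card1 u);
    apply: eq_card => w; rewrite !inE eq_sym.
- by rewrite card_prod !card_ord mulnC.
- by rewrite card_prod !card_ord mulnC mul1n.
- by rewrite card_prod !card_ord mulnC mul1n addn0.
- by rewrite card_prod !card_ord mulnC !addn0.
Qed.

(** Each component is the complement of [k.+1] disjoint 4-cycles. For [k = 1] five of them are
    replaced by four copies of [K_6] and a graph with the Clebsch parameters, for [k = 2] three by
    two copies of [K_10] and one with those of the rook complement. *)
Lemma chain_not_DS (gT : finGroupType) (G B D F : {group gT}) (k c mu : nat)
    (e16 : nat -> nat -> bool) :
    F \subset D -> D \subset B -> B \subset G ->
    #|F| = 2 -> #|D| = 4 -> #|B| = (4 * k.+1)%N ->
    (k == 1)%N && (c == 4) || (k == 2) && (c == 2) ->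
    (c < #|G : B|%g)%N ->
    srg16 mu e16 -> (mu + 2 = 4 * k)%N ->
  ~ DS G.
Proof.
move=> sFD sDB sBG oF oD oB kc ltcm srg mu_k dsG.
have sDG := subset_trans sDB sBG; have sFG := subset_trans sFD sDG.
have sFB := subset_trans sFD sDB.
pose S := ((B :\: D) :|: F^#)%g.
have connS : connection_set G S.
  split; last by apply/setP => g; rewrite !inE !groupV invg_eq1.
  apply/subsetP => g; rewrite !inE; case/orP => /andP[].
    move=> nDg Bg; rewrite (subsetP sBG) // andbT.
    by apply: contraNneq nDg => ->; apply: group1.
  by move=> -> /(subsetP sFG).
(* c.+1 of the components are traded for c complete graphs and one strongly
   regular graph. *)
pose q := (#|G : B|%g - c.+1)%N.
pose cr (H : {group gT}) := @copies_rel q _ (@coset_rel _ B H).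
pose eC := chain_rel (cr B) (cr D) (cr F).
pose eK := chain_rel (@copies_rel c _ (@full_rel 'I_(4 * k + 1).+1))
     (@copies_rel c _ eq_op) (@copies_rel c _ eq_op).
pose e := sum_graph eC (sum_graph eK (@ord_graph 16 e16)).
have sim_e : simple_graph e.
  apply: sum_graph_simple; last apply: sum_graph_simple.
  - by apply: chain_rel_simple; apply/copies_rel_equiv/coset_rel_equiv.
  - by apply: chain_rel_simple; apply/copies_rel_equiv => // x y z;
      split=> // /eqP ->.
  by have [] := srg16P srg.
have cosp : cospectral (Cay G S) e.
  apply: cospectral_char_poly; rewrite (eq_adj_mx (@Cay_chain_rel _ G B D F)).
  rewrite !char_poly_sum_graph (@char_poly_srg16 mu k.+1) //; last first.
  - by case/orP: kc => /andP[/eqP -> _].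
  - by rewrite mulnS -mu_k; ring.
  have [eB eD eF] : [/\ equivalence_rel (cr B), equivalence_rel (cr D) &
    equivalence_rel (cr F)].
    by split; apply/copies_rel_equiv/coset_rel_equiv.
  have subcr (H K : {group gT}) : H \subset K -> subrel (cr H) (cr K).
    by move=> sHK; apply/copies_rel_sub/coset_rel_sub.
  have cardcr (H : {group gT}) v : H \subset B -> #|cr H v| = #|H|.
    by move=> sHB; apply: card_copies_rel => a; apply: card_coset_rel.
  have oVC : #|{: 'I_q * [subg B]}| = (4 * k.+1 * q)%N.
    by rewrite card_prod card_ord card_sub -oB mulnC; congr (_ * _)%N;
      apply: eq_card.
  have oVG : #|[subg G]| = (4 * k.+1 * #|G : B|%g)%N.
    by rewrite card_sub -oB Lagrange //; apply: eq_card.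
  rewrite (char_poly_coset_chain eB eD eF (subcr _ _ sFD) (subcr _ _ sDB) _ _ _
    oVC) => [|v|v|v].
  2, 3, 4: by rewrite cardcr.
  have eq_cos (H : {group gT}) : equivalence_rel (@coset_rel _ G H) by apply:
    coset_rel_equiv.
  rewrite char_poly_copies_complete (char_poly_coset_chain (eq_cos B) (eq_cos D)
    (eq_cos F) (coset_rel_sub sFD) (coset_rel_sub sDB) _ _ _ oVG) => [|v|v|v].
  2, 3, 4: by rewrite card_coset_rel.
  have -> : (4 * k + 1)%:R = 4 * k.+1%:R - 3 :> algC by rewrite -natr1 natrD
    natrM; ring.
  (* The [q] untouched components cancel; what remains compares exponents of four linear factors,
     treated as indeterminates. *)
  rewrite -{1}(subnK ltcm) -/q exprD; congr (_ * _).
  move: ('X - (_ - _)%:P) ('X - (-3)%:P) ('X - 1%:P) ('X - (-1)%:P) => a a3 a1 b1.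
  by case/orP: kc => /andP[/eqP -> /eqP ->]; rewrite /= ?subSS ?subn0; ring.
have [h [h' hK h'K] hE] := dsG S connS _ _ sim_e cosp.
(* In the Cayley graph [s * v] and [d * s * v] are nonadjacent neighbours of [v], for [d] in [D]
   outside [F]. No vertex of a complete component has such a pair. *)
have [s Bs nDs] : exists2 s, s \in B & s \notin D.
  apply/subsetPn; apply/negP => /subset_leq_card; rewrite oB oD.
  by case/orP: kc => /andP[/eqP -> _].
have [d Dd nFd] : exists2 d, d \in D & d \notin F.
  by apply/subsetPn; apply/negP => /subset_leq_card; rewrite oF oD.
have c_gt0 : (0 < c)%N by case/orP: kc => /andP[_ /eqP ->].
pose w : 'I_q * [subg B] + ('I_c * 'I_(4 * k + 1).+1 + 'I_16) := inr (inl
  (Ordinal c_gt0, ord0)).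
pose v := h' w.
have Gs := subsetP sBG s Bs; have Gd := subsetP sDG d Dd.
pose v1 := subg G (s * sgval v)%g; pose v2 := subg G (d * s * sgval v)%g.
have v1E : sgval v1 = (s * sgval v)%g by rewrite subgK ?groupM ?subgP.
have v2E : sgval v2 = (d * s * sgval v)%g by rewrite subgK ?groupM ?subgP.
have e1 : e (h v1) w.
  by rewrite -[w]h'K hE /Cay -/v v1E mulgK !inE Bs nDs.
have e2 : e (h v2) w.
  rewrite -[w]h'K hE /Cay -/v v2E mulgK !inE groupMl // nDs groupMr //.
  by rewrite (subsetP sDB).
have n12 : h v1 != h v2.
  rewrite (inj_eq (can_inj hK)) -(inj_eq subg_inj) v1E v2E.
  rewrite (inj_eq (mulIg _)) -{1}[s]mul1g (inj_eq (mulIg _)) eq_sym.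
  by apply: contraNneq nFd => ->; apply: group1.
have ne12 : ~~ e (h v1) (h v2).
  rewrite hE /Cay v1E v2E !invMg !mulgA mulgK mulgV mul1g !inE !groupV Dd.
  by rewrite (negPf nFd) !andbF.
move: e1 e2 n12 ne12; case: (h v1) => [//|[[i1 x1]|//]];
  case: (h v2) => [//|[[i2 x2]|//]].
rewrite /e /= /eK /chain_rel /copies_rel /full_rel /w /= => h1 h2 n12 ne12.
have i1E : i1 == Ordinal c_gt0 by case/orP: h1 => /andP[/andP[]].
have i2E : i2 == Ordinal c_gt0 by case/orP: h2 => /andP[/andP[]].
move: ne12 n12; rewrite (eqP i1E) (eqP i2E) eqxx /= => /norP[/negPn/eqP -> _].
by rewrite eqxx.
Qed.

Local Close Scope ring_scope.
Local Open Scope group_scope.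

(** * Sylow subgroups for the least prime divisor *)

(** Burnside's argument: [P] and [P :^ u] are Sylow subgroups of the centraliser of [x ^ u], hence
    conjugate in it, so [x] is taken to [x ^ u] by an element of the normaliser of [P]. *)
Lemma abelian_Sylow_fusion (gT : finGroupType) (p : nat) (G P : {group gT}) :
    p.-Sylow(G) P -> abelian P -> 'N_G(P) \subset 'C(P) ->
  forall x u, x \in P -> u \in G -> x ^ u \in P -> x ^ u = x.
Proof.
move=> sylP cPP cPN x u Px Gu Pxu.
have sylPC (R : {group gT}) : p.-Sylow(G) R -> R \subset 'C[x ^ u] ->
    p.-Sylow('C_G[x ^ u]) R.
  move=> sylR cR; apply: (pHall_subl _ (subsetIl _ _) sylR).
  by rewrite subsetI cR (pHall_sub sylR).
have sylPx : p.-Sylow('C_G[x ^ u]) P.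
  by apply: sylPC => //; rewrite sub_cent1 (subsetP cPP).
have sylPux : p.-Sylow('C_G[x ^ u]) (P :^ u)%G.
  apply: sylPC; first by rewrite pHallJ.
  by rewrite sub_cent1 centJ memJ_conjg (subsetP cPP).
have [c /setIP[Gc cxc] defPc] := Sylow_trans sylPx sylPux.
have Nuc : u * c^-1 \in 'N_G(P).
  rewrite inE groupM ?groupV //; apply/normP.
  by rewrite conjsgM /= defPc -conjsgM mulgV conjsg1.
have := subsetP cPN _ Nuc => /centP/(_ x Px) cx.
have : x ^ (u * c^-1) = x by rewrite conjgE -cx mulKg.
move/cent1P: cxc => cxc.
by rewrite conjgM [(x ^ u) ^ _]conjgE invgK mulgA cxc mulgK.
Qed.

(** The transfer into the abelian group [P] kills a perfect group, whereas on [P] it is the power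
    map with exponent the index of [P], which is injective there. *)
Lemma perfect_Sylow_trivial (gT : finGroupType) (p : nat) (G P : {group gT}) :
    p.-Sylow(G) P -> abelian P -> 'N_G(P) \subset 'C(P) ->
  G \subset G^`(1) -> P :=: 1.
Proof.
move=> sylP cPP cPN perfG; have [sPG pP p'GP] := and3P sylP.
have fus := abelian_Sylow_fusion sylP cPP cPN.
have abP : abelian (idm P @* P) by rewrite morphim_idm.
pose V := transfer G abP.
have V0 g : g \in G -> V g = 0%R.
  move=> Gg; have: V g \in V @* G^`(1).
    by apply: mem_morphim => //; apply: (subsetP perfG).
  rewrite morphim_der // (derG1P _) ?inE; first by move/eqP.
  by apply/centsP => a _ b _; rewrite /commute; apply: GRing.addrC.
apply/trivgP/subsetP => g Pg; rewrite inE; have Gg := subsetP sPG g Pg.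
have Pg' : g \in (idm P @* P)%G by apply: (mem_morphim (idm_morphism P)).
have [X trX] : exists X, is_transversal X (rcosets P G :* <[g]>) G.
  exists (transversal (rcosets P G :* <[g]>) G).
  by apply: transversalP; apply: rcosets_cycle_partition.
have := V0 g Gg; rewrite /V (transfer_cycle_expansion sPG abP Gg trX).
have sumX := sum_index_rcosets_cycle sPG Gg trX.
(* Each factor of the transfer is a conjugate in [P] of a power of [g], so by fusion it is that
   power itself. *)
under eq_bigr => x Xx.
  have -> : (g ^+ #|<[g]> : P :* x|) ^ x^-1 = g ^+ #|<[g]> : P :* x|.
    apply: fus; rewrite ?groupX ?groupV //.
      by apply: (subsetP (transversal_sub trX)).
    by rewrite conjgE invgK mulgA -mem_rcoset mulg_exp_card_rcosets.
  rewrite /= (_ : restrm _ _ _ = (fmod abP g *+ #|<[g]> : P :* x|)%R); last first.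
    by rewrite /restrm /= /idm fmodX.
  over.
rewrite /= GRing.sumrMnr sumX => /(congr1 (@fmval _ _ _)).
rewrite fmvalZ fmodK // => gn1.
have co_gn : coprime #[g] #|G : P|.
  apply: (@pnat_coprime p) p'GP; apply: pnat_dvd (order_dvdG Pg) _; exact: pP.
rewrite -order_eq1 -dvdn1 -(Gauss_dvdr _ co_gn) muln1 order_dvdn.
by apply/eqP.
Qed.

(** The normaliser is generated by its Sylow subgroups, so one of them fails to centralise [P]; it
    is not a [p]-group, as [P] is abelian and normal there. *)
Lemma non_central_Sylow (gT : finGroupType) (p : nat) (G P : {group gT}) :
    p.-Sylow(G) P -> abelian P -> ~~ ('N_G(P) \subset 'C(P)) ->
  exists2 q, [/\ prime q, q != p & q %| #|'N_G(P)| ] &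
    exists Q : {group gT}, [/\ q.-group Q, Q \subset 'N_G(P) & ~~ (Q \subset
      'C(P))].
Proof.
move=> sylP cPP ncN.
have : ~~ [forall R : {group gT}, Sylow 'N_G(P) R ==> (R \subset 'C(P))].
  apply: contra ncN => /forallP sC; rewrite -(Sylow_gen 'N_G(P)) gen_subG.
  by apply/bigcupsP => R sylR; have /implyP := sC R; apply.
case/forallPn => Q; rewrite negb_imply => /andP[/SylowP[q q_pr sylQ] ncQ].
exists q; last by exists Q; rewrite (pHall_pgroup sylQ) (pHall_sub sylQ).
have neqp : q != p.
  apply: contra ncQ => /eqP eqp; rewrite eqp in sylQ.
  have sylPN : p.-Sylow('N_G(P)) P.
    apply: (pHall_subl _ (subsetIl _ _) sylP).
    by rewrite subsetI normG (pHall_sub sylP).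
  apply: subset_trans cPP; rewrite (sub_normal_Hall sylPN) ?(pHall_sub sylQ) //.
    exact: pHall_pgroup sylQ.
  by rewrite /normal subsetIr (pHall_sub sylPN).
split=> //; have : Q :!=: 1 by apply: contraNneq ncQ => ->; apply: sub1G.
case/(pgroup_pdiv (pHall_pgroup sylQ)) => _ qQ _.
exact: dvdn_trans qQ (cardSg (pHall_sub sylQ)).
Qed.

(** A noncentral [q]-subgroup of the normaliser acts nontrivially on [P], so [q] divides the totient
    of a power of [p], hence [p - 1]; this contradicts the minimality of [p]. *)
Lemma cyclic_Sylow_pdiv (gT : finGroupType) (G P : {group gT}) :
  (pdiv #|G|).-Sylow(G) P -> cyclic P -> 'N_G(P) \subset 'C(P).
Proof.
set p := pdiv _ => sylP cycP; apply: contraT.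
case/(non_central_Sylow sylP (cyclic_abelian cycP)) => q [q_pr neqp qN].
case=> Q [qQ sQN ncQ].
have sQN' : Q \subset 'N(P) by apply: subset_trans sQN (subsetIr _ _).
have leqpq : p <= q.
  apply: pdiv_min_dvd (prime_gt1 q_pr) _.
  exact: dvdn_trans qN (cardSg (subsetIl _ _)).
have dvQ : #|conj_aut P @* Q| %| totient #|P|.
  by rewrite -card_Aut_cyclic // cardSg // Aut_conj_aut.
have ntQ : conj_aut P @* Q != 1.
  apply: contra ncQ => /eqP/trivgP; rewrite sub_morphim_pre //.
  by rewrite -ker_conj_aut /ker.
case/(pgroup_pdiv (morphim_pgroup _ qQ)): ntQ => _ qd _.
have := dvdn_trans qd dvQ.
have [-> |ntP] := eqsVneq P 1.
  by rewrite cards1 dvdn1 => /eqP q1; rewrite q1 in q_pr.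
have [p_pr pP [k oP]] := pgroup_pdiv (pHall_pgroup sylP) ntP.
rewrite oP totient_pfactor //= Euclid_dvdM // => /orP[]; last first.
  rewrite Euclid_dvdX // => /andP[]; rewrite dvdn_prime2 //.
  by rewrite (negPf neqp).
move=> qp1; have := dvdn_leq _ qp1; rewrite -subn1 subn_gt0 prime_gt1 //.
move/(_ isT); rewrite leqNgt => /negP[]; apply: leq_trans leqpq.
by rewrite subn1 ltn_predL prime_gt0.
Qed.

(** Counting fixed points of a noncentral [q]-subgroup, [q] divides [p^2 - 1] or [p^2 - p]. As
    [q > p], this gives [q = p + 1], so [p = 2] and [q = 3]. *)
Lemma Sylow_p2_pdiv (gT : finGroupType) (G P : {group gT}) (p := pdiv #|G|) :
    p.-Sylow(G) P -> #|P| = (p ^ 2)%N -> prime p ->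
  'N_G(P) \subset 'C(P) \/ p = 2 /\ 3 %| #|'N_G(P)|.
Proof.
move=> sylP oP p_pr; have cPP := card_p2group_abelian p_pr oP.
case: (boolP (_ \subset _)) => [|ncN]; [by left | right].
case/(non_central_Sylow sylP cPP): ncN => q [q_pr neqp qN] [Q [qQ sQN ncQ]].
have sQN' : Q \subset 'N(P) by apply: subset_trans sQN (subsetIr _ _).
have leqpq : p < q.
  rewrite ltn_neqAle eq_sym neqp; apply: pdiv_min_dvd (prime_gt1 q_pr) _.
  exact: dvdn_trans qN (cardSg (subsetIl _ _)).
have actQ : [acts Q, on P | 'J] by rewrite astabsJ.
have := pgroup_fix_mod qQ actQ; rewrite afixJ oP => fixQ.
have sCP : 'C_P(Q) \proper P.
  by rewrite properE subsetIl subsetI subxx /= centsC.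
have : #|'C_P(Q)| %| p ^ 2 by rewrite -oP cardSg ?subsetIl.
case/(dvdn_pfactor _ _ p_pr) => k lek oC.
have ltk : k < 2.
  by have := proper_card sCP; rewrite oP oC ltn_exp2l ?prime_gt1.
have qdvd : q %| p + 1.
  move: fixQ => /eqP; rewrite oC eqn_mod_dvd ?leq_exp2l ?prime_gt1 //.
  have coqp : coprime q p by rewrite prime_coprime // dvdn_prime2.
  have nq1 : ~~ (q %| p - 1).
    rewrite gtnNdvd ?subn_gt0 ?prime_gt1 //.
    exact: leq_ltn_trans (leq_subr _ _) leqpq.
  case: k ltk {lek oC} => [|[|//]] _.
    rewrite expn0 -{2}(exp1n 2) subn_sqr Euclid_dvdM // (negPf nq1).
    by [].
  rewrite expn1 -{2}(muln1 p) expnS expn1 -mulnBr Gauss_dvdr //.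
  by rewrite (negPf nq1).
have eq : q = p.+1.
  apply/eqP; rewrite eqn_leq leqpq andbT -addn1; apply: dvdn_leq => //.
  by rewrite addn1.
have p2 : p = 2.
  case: (even_prime p_pr) => // oddp.
  case: (even_prime q_pr) => [q2|]; last by rewrite eq /= oddp.
  by move: leqpq; rewrite q2; case: (p) p_pr => [|[|]].
by split=> //; rewrite -[3]/(2.+1) -p2 -eq.
Qed.

(** * Groups that are not DS *)

Lemma odd_mulgg (gT : finGroupType) (H : {group gT}) (x : gT) :
  odd #[x] -> x * x \in H -> x \in H.
Proof.
move=> odd_x Hxx; have -> : x = (x ^+ 2) ^+ (#[x].+1)./2.
  rewrite -expgM mul2n -[_.*2]add0n -(_ : odd #[x].+1 = 0 :> nat)
    ?odd_double_half.
    by rewrite expgS expg_order mulg1.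
  by rewrite /= odd_x.
by rewrite groupX // expgS expg1.
Qed.

Lemma index_ge5 (gT : finGroupType) (G B : {group gT}) (r : nat) :
    B \subset G -> prime r -> 5 <= r -> r %| #|G| -> coprime r #|B| ->
  5 <= #|G : B|.
Proof.
move=> sBG r_pr r_ge5; rewrite -(Lagrange sBG) => r_dv co_rB.
apply: leq_trans r_ge5 (dvdn_leq (indexg_gt0 _ _) _).
by rewrite -(Gauss_dvdr _ co_rB).
Qed.

Lemma prime_ge5 (n : nat) :
  ~~ (size (primes n) <= 2) -> exists2 r, prime r & (5 <= r) && (r %| n).
Proof.
move=> big; have /allPn[r] : ~~ all (mem [:: 2; 3]) (primes n).
  apply: contra big => /allP sub23; apply: (@uniq_leq_size _ _ [:: 2; 3]) sub23.
  exact: primes_uniq.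
rewrite mem_primes => /and3P[r_pr _ r_dv] nr; exists r => //; rewrite r_dv andbT.
by case: r r_pr nr {r_dv} => [|[|[|[|[|r]]]]].
Qed.

(** A noncyclic [P] has two distinct maximal subgroups; they are normal of index [p] and meet
    nontrivially by order. In odd order an element is a power of its square, so the square
    conditions of the switching hold. *)
Lemma odd_pgroup_not_DS (gT : finGroupType) (p : nat) (G P : {group gT}) :
    odd p -> p.-group P -> P \subset G -> ~~ cyclic P -> p ^ 3 <= #|P| ->
  ~ DS G.
Proof.
move=> odd_p pP sPG ncP oP.
have ntP : P :!=: 1 by apply: contraNneq ncP => ->; apply: cyclic1.
have [p_pr _ [n oPn]] := pgroup_pdiv pP ntP.
have [P1 | [M1 maxM1 _]] := maximal_exists (sub1G P);
  first by rewrite P1 eqxx in ntP.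
have [sM1P ltM1] := (proper_sub (maxgroupp maxM1), maxgroupp maxM1).
have [_ [y Py nM1y]] := properP ltM1.
have syP : <[y]> \subset P by rewrite cycle_subG.
have [Py' | [M2 maxM2]] := maximal_exists syP;
  first by rewrite -Py' cycle_cyclic in ncP.
rewrite cycle_subG => M2y; have sM2P := proper_sub (maxgroupp maxM2).
have oM (M : {group gT}) : maximal M P -> #|M| = (p ^ n)%N.
  move=> maxM; have sMP := proper_sub (maxgroupp maxM).
  apply/eqP; rewrite -(eqn_pmul2r (prime_gt0 p_pr)) -expnSr -oPn.
  by rewrite -{1}(p_maximal_index pP maxM) Lagrange.
have [x M1x nM2x] : exists2 x, x \in M1 & x \notin M2.
  apply/subsetPn; apply: contra nM1y => sM12.
  suff -> : M1 :=: M2 by [].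
  by apply/eqP; rewrite eqEcard sM12 !oM ?leqnn.
have [k /setIP[M1k M2k] ntk] : exists2 k, k \in M1 :&: M2 & k != 1.
  apply/trivgPn; apply: contraL oP => /eqP ti12; rewrite -ltnNge.
  have : #|M1 * M2| <= #|P| by rewrite subset_leq_card // mul_subG.
  rewrite TI_cardMg // (oM M1) // (oM M2) // oPn -expnD leq_exp2l ?prime_gt1 //
    ltn_exp2l ?prime_gt1 //.
  by move=> le_nn; rewrite !ltnS -(leq_add2l n) addn1.
have oddP z : z \in P -> odd #[z].
  move=> Pz; apply: dvdn_odd (order_dvdG Pz) _; rewrite oPn oddX odd_p orbT //.
apply: (@switching_not_DS _ G M1 M2 x y k); rewrite ?(subset_trans _ sPG) //.
- by rewrite (subsetP (normal_norm (p_maximal_normal pP maxM2))) ?(subsetP sM1P).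
- by apply: contra nM2x; apply: odd_mulgg; rewrite oddP ?(subsetP sM1P).
- by apply: contra nM1y; apply: odd_mulgg; rewrite oddP.
Qed.

Lemma order8_not_DS (gT : finGroupType) (G P : {group gT}) (r : nat) :
    2.-group P -> P \subset G -> 8 <= #|P| -> prime r -> 5 <= r -> r %| #|G| ->
  ~ DS G.
Proof.
move=> pP sPG oP r_pr r_ge5 r_dv.
have sub2 (Q : {group gT}) n : 2.-group Q -> 2 ^ n <= #|Q| ->
    exists2 R : {group gT}, R \subset Q & #|R| = (2 ^ n)%N.
  move=> pQ; rewrite (card_pgroup pQ) leq_exp2l // => /(normal_pgroup pQ
    (normal_refl Q)).
  by case=> R [sRQ _ oR]; exists R.
have [B sBP oB] := sub2 P 3 pP oP; have pB := pgroupS sBP pP.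
have [|D sDB oD] := sub2 B 2 pB; first by rewrite oB.
have [|F sFD oF] := sub2 D 1%N (pgroupS sDB pB); first by rewrite oD.
have sBG := subset_trans sBP sPG.
apply: (@chain_not_DS _ G B D F 1%N 4 2 clebsch _ _ _ _ _ _ _ _ srg16_clebsch) =>
  //.
apply: (index_ge5 sBG r_pr r_ge5 r_dv); rewrite oB.
by rewrite (coprimeXr 3) // coprime_sym prime_coprime // dvdn_prime2 // neq_ltn
  (leq_trans _ r_ge5).
Qed.

(** [P] and [x] generate a subgroup of order 12; its index is divisible by [r], hence exceeds 2. *)
Lemma order12_not_DS (gT : finGroupType) (G P : {group gT}) (x : gT) (r : nat) :
    #|P| = 4 -> P \subset G -> x \in 'N_G(P) -> #[x] = 3 ->
    prime r -> 5 <= r -> r %| #|G| ->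
  ~ DS G.
Proof.
move=> oP sPG /setIP[Gx nPx] ox r_pr r_ge5 r_dv.
have nPX : <[x]> \subset 'N(P) by rewrite cycle_subG.
pose B := (P <*> <[x]>)%G.
have oB : #|B| = 12.
  by rewrite /= norm_joinEr // coprime_cardMg ?oP -?orderE ?ox.
have sBG : B \subset G by rewrite join_subG sPG cycle_subG.
have two_dv : 2 %| #|P| by rewrite oP.
have [z Pz oz] := Cauchy (isT : prime 2) two_dv.
apply: (@chain_not_DS _ G B P <[z]>%G 2 2 6 corook _ _ _ _ _ _ _ _ srg16_corook)
  => //.
- by rewrite cycle_subG.
- exact: joing_subl.
- apply: leq_trans (index_ge5 sBG r_pr r_ge5 r_dv _); rewrite // oB.
  by rewrite prime_coprime //;
    case: r r_pr r_ge5 {r_dv} => [|[|[|[|[|[|[|[|[|[|[|[|[|r]]]]]]]]]]]]] // _ _;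
    rewrite gtnNdvd.
Qed.

(** * The minimal nonsolvable subgroup *)

Theorem theorem1p4 (gT : finGroupType) (G : {group gT}) :
  DS G -> solvable G.
Proof.
(* The induction runs over subgroups of the fixed [G]: the forbidden subgroups are found in [H], but
   [DS] is applied to [G]. *)
move=> dsG; suff solH n (H : {group gT}) : H \subset G -> #|H| <= n -> solvable H.
  exact: solH (subxx _) (leqnn _).
elim: n H => [|n IHn] H sHG leHn; first by rewrite leqNgt cardG_gt0 in leHn.
apply: contraT => nsolH.
have perfH : H \subset H^`(1).
  apply: contraR nsolH => nsub.
  have ltH' : H^`(1) \proper H by rewrite properE der_sub.
  rewrite (series_sol (der_normal 1 H)) (abelian_sol (der_abelian 0 H)) andbT.
  apply: IHn; first exact: subset_trans (der_sub 1 H) sHG.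
  by rewrite -ltnS (leq_trans (proper_card ltH')).
(* By Burnside's theorem three primes divide the order of [H], so one is at least 5; it makes the
   indices of subgroups of order 8 or 12 large enough. *)
have big : ~~ (size (primes #|H|) <= 2) by apply: contra nsolH;
  apply: Burnside_p_a_q_b.
have [r r_pr /andP[r_ge5 r_dvH]] := prime_ge5 big.
have r_dv := dvdn_trans r_dvH (cardSg sHG).
have H_gt1 : 1 < #|H| by apply: leq_trans (dvdn_leq (cardG_gt0 _) r_dvH);
  apply: prime_gt1.
have p_pr := pdiv_prime H_gt1; set p := pdiv _ in p_pr.
have [P sylP] := Sylow_exists p H.
have [sPH pP _] := and3P sylP; have sPG := subset_trans sPH sHG.
have ntP : P :!=: 1.
  by rewrite -rank_gt0 (rank_Sylow sylP) p_rank_gt0 pi_pdiv.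
have nabP : abelian P -> ~~ ('N_H(P) \subset 'C(P)).
  move=> abP; apply/negP => cPN.
  by move/eqP: ntP; apply; apply: perfect_Sylow_trivial sylP abP cPN perfH.
have ncP : ~~ cyclic P.
  by apply/negP => cP; have /negP[] := nabP (cyclic_abelian cP);
    apply: cyclic_Sylow_pdiv.
have [_ _ [m oP]] := pgroup_pdiv pP ntP.
(* The order of [P] is [p ^ m.+1], so the cases are [p], [p ^ 2] and at least [p ^ 3]. *)
case: m oP => [oP | [oP | m oP]].
- by case/negP: ncP; rewrite prime_cyclic // oP.
- have [cPN | [p2 /Cauchy[// | x Nx ox]]] := Sylow_p2_pdiv sylP oP p_pr.
    by case/negP: (nabP (card_p2group_abelian p_pr oP)).
  case: (@order12_not_DS _ G P x r) => //; first by rewrite oP (p2 : p = 2).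
  by apply: subsetP Nx; rewrite setSI.
have le3 : p ^ 3 <= #|P| by rewrite oP leq_exp2l ?prime_gt1.
have [p2 | odd_p] := even_prime p_pr.
  by rewrite p2 in pP le3; case: (order8_not_DS pP sPG le3 r_pr r_ge5 r_dv).
by case: (odd_pgroup_not_DS odd_p pP sPG ncP le3).
Qed.
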